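(* Let $r>0$ and $\mathsf c(x,\bar x)=-\frac{\operatorname{arcsinh}(r\,x^{\mathsf T}\bar x)}{r}$. Let $\phi$ be a $\mathsf c$-convex potential of $\mathsf c$-Legendre type on a domain $\Omega\subset\mathbb R^n$, with third-order derivative tensor $\phi^{(3)}$. For $x\in\Omega$ let $\mathtt g=\mathrm{grad}_\phi(x)$ and $\mathtt h=\mathrm{hess}_\phi(x)$, considered as a matrix. Then the divergence metric of the $\mathsf c$-divergence $$\mathfrak D[x:x']=\phi(x)-\phi(x')-\frac1r\log\frac{r x^{\mathsf T}\mathrm{grad}_\phi(x')+\big(r^2(x^{\mathsf T}\mathrm{grad}_\phi(x'))^2-r^2((x')^{\mathsf T}\mathrm{grad}_\phi(x'))^2+1\big)^{1/2}}{r(x')^{\mathsf T}\mathrm{grad}_\phi(x')+1}$$ is given by the operator $\mathrm{hess}^{\mathsf c}_\phi(x)\xi=\mathtt h\xi+r^2(x^{\mathsf T}\mathtt g\;\mathtt g^{\mathsf T}\xi)\mathtt g$. The dualistic pair of connections is given by $$\Gamma^1(x;\xi_1,\xi_2)=-r^2\big((\mathtt g^{\mathsf T}\xi_1\,\mathtt g^{\mathsf T}\xi_2)x+(x^{\mathsf T}\mathtt g\,\mathtt g^{\mathsf T}\xi_2)\xi_1+(x^{\mathsf T}\mathtt g\,\mathtt g^{\mathsf T}\xi_1)\xi_2\big),$$ $$\Gamma^{-1}(x;\xi_1,\xi_2)=(\mathrm{hess}^{\mathsf c}_\phi(x))^{-1}\Big(\phi^{(3)}(\xi_1,\xi_2)+r^2(x^{\mathsf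 T}\mathtt g\,\xi_1^{\mathsf T}\mathtt g)\mathtt h\xi_2+r^2(\xi_2^{\mathsf T}\mathtt g\,x^{\mathsf T}\mathtt g)\mathtt h\xi_1$$ $$\qquad+r^2\big((1+3r^2(x^{\mathsf T}\mathtt g)^2)\,\xi_1^{\mathsf T}\mathtt g\,\xi_2^{\mathsf T}\mathtt g+2(\xi_1^{\mathsf T}\mathtt h\xi_2)x^{\mathsf T}\mathtt g+\xi_2^{\mathsf T}\mathtt g\,(x^{\mathsf T}\mathtt h\xi_1)+\xi_1^{\mathsf T}\mathtt g\,(x^{\mathsf T}\mathtt h\xi_2)\big)\mathtt g\Big).$$ For $\xi_1,\xi_2,\xi_3\in\mathbb R^n$, the cubic Amari-Chentsov tensor $\mathrm C(\xi_1,\xi_2,\xi_3):=\xi_3^{\mathsf T}\mathrm{hess}^{\mathsf c}_\phi(x)\big(\Gamma^{-1}(\xi_1,\xi_2)-\Gamma^1(\xi_1,\xi_2)\big)$ is $$\mathrm C(\xi_1,\xi_2,\xi_3)=\phi^{(3)}(\xi_1,\xi_2,\xi_3)+r^2\Big(2x^{\mathsf T}\mathtt g\big(\xi_1^{\mathsf T}\mathtt g\,\xi_2^{\mathsf T}\mathtt h\xi_3+\xi_2^{\mathsf T}\mathtt g\,\xi_1^{\mathsf T}\mathtt h\xi_3+\xi_3^{\mathsf T}\mathtt g\,\xi_2^{\mathsf T}\mathtt h\xi_1\big)$$ $$\qquad+(1+6r^2(x^{\mathsf T}\mathtt g)^2)\,\xi_3^{\mathsf T}\mathtt g\,\xi_1^{\mathsf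 T}\mathtt g\,\xi_2^{\mathsf T}\mathtt g+\xi_3^{\mathsf T}\mathtt g\,\xi_2^{\mathsf T}\mathtt g\,x^{\mathsf T}\mathtt h\xi_1+\xi_1^{\mathsf T}\mathtt g\,\xi_2^{\mathsf T}\mathtt g\,x^{\mathsf T}\mathtt h\xi_3+\xi_3^{\mathsf T}\mathtt g\,\xi_1^{\mathsf T}\mathtt g\,x^{\mathsf T}\mathtt h\xi_2\Big),$$ and it is a symmetric tensor.
   Context: Setting: $\Omega,\bar\Omega\subset\mathbb R^n$ are domains and $\mathsf c$ is a cost on $\Omega\times\bar\Omega$; functions are assumed sufficiently smooth ($\phi$ at least $C^3$). Gradients and Hessians are with respect to the standard inner product; $\phi^{(3)}(\xi_1,\xi_2)$ is the vector with $\xi_3^{\mathsf T}\phi^{(3)}(\xi_1,\xi_2)=\phi^{(3)}(\xi_1,\xi_2,\xi_3)$. $D,\bar D$ are directional derivatives, and $\mathcal D,\bar{\mathcal D}$ gradients, in the first and second variable of $\mathsf c$. The transforms are $\phi^{\bar{\mathsf c}}(\bar x)=\sup_x(-\mathsf c(x,\bar x)-\phi(x))$ and $\psi^{\mathsf c}(x)=\sup_{\bar x}(-\mathsf c(x,\bar x)-\psi(\bar x))$; $\phi$ is $\mathsf c$-convex if $\phi=\psi^{\mathsf c}$ for some $\psi$, equivalently $\phi^{\bar{\mathsf c}\mathsf c}=\phi$. For a $\mathsf c$-convex $\phi$ such that for each $\bar x\in\bar\Omega$ the maximum of $x\mapsto-\mathsf c(x,\bar x)-\phi(x)$ is attained at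 a unique (interior) point $x$ of $\Omega$, the optimal map $\mathbf T=\mathbf T_\phi$ is the inverse of $\bar x\mapsto x$ (assumed well defined); write $x_{\mathbf T}=\mathbf T(x)$. It satisfies $\mathcal D\mathsf c(x,x_{\mathbf T})+\mathrm{grad}_\phi(x)=0$. The $\mathsf c$-Hessian is $\mathrm{hess}^{\mathsf c}_\phi(x)\xi=(D_\xi\mathcal D\mathsf c)(x,x_{\mathbf T})+\mathrm{hess}_\phi(x)\xi$ (where $x_{\mathbf T}$ is held fixed in the derivative $D_\xi$). The potential $\phi$ is of $\mathsf c$-Legendre type if $\mathbf T_\phi$ is a diffeomorphism from $\Omega$ onto $\bar\Omega$ and $\mathrm{hess}^{\mathsf c}_\phi(x)$ is positive definite for all $x\in\Omega$. The $\mathsf c$-divergence is $\mathfrak D[x:x']=\mathsf c(x,x'_{\mathbf T})+\phi(x)-\mathsf c(x',x'_{\mathbf T})-\phi(x')$; for the cost of this statement it takes the form displayed in the claim. With $D',\mathcal D'$ denoting derivative and gradient in $x'$, and $D,\mathcal D$ those in $x$: the divergence metric is the symmetric operator $G$ on $\mathbb R^n$ with $\xi^{\mathsf T}G\xi=-(D'_\xi D_\xi\mathfrak D)|_{x'=x}$. The dualistic pair of connections (primal $\Gamma^1$, dual $\Gamma^{-1}$) is given by the Christoffel functions $\Gamma^1(x;\xi_1,\xi_2)=\big((D\mathcal D'\mathfrak D)^{-1}D_{\xi_1}D_{\xi_2}\mathcal D'\mathfrak D\big)|_{x'=x}$ and $\Gamma^{-1}(x;\xi_1,\xi_2)=\big((D'\mathcal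 D\mathfrak D)^{-1}D'_{\xi_1}D'_{\xi_2}\mathcal D\mathfrak D\big)|_{x'=x}$, where $D\mathcal D'\mathfrak D$ is the operator $\xi\mapsto D_\xi\mathcal D'\mathfrak D$ and $D'\mathcal D\mathfrak D$ the operator $\xi\mapsto D'_\xi\mathcal D\mathfrak D$. *)

(* Defs.v *)
From mathcomp Require Import all_boot all_order all_algebra.
From mathcomp Require Import all_classical all_reals all_analysis.
Import Order.TTheory GRing.Theory Num.Theory.
Import numFieldNormedType.Exports.

Set Implicit Arguments.
Unset Strict Implicit.
Unset Printing Implicit Defensive.

Local Open Scope classical_set_scope.
Local Open Scope ring_scope.

(* R^n is 'cV[R]_n.  The library norms it by the maximum norm, which is
   equivalent to the Euclidean one, so open sets, limits and derivatives are the
   usual ones; only gradients depend on the inner product [dot]. *)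
Definition dot (R : realType) (n : nat) (u v : 'cV[R]_n) : R :=
  (u^T *m v) 0 0.

Definition grad (R : realType) (n : nat) (f : 'cV[R]_n -> R) (x : 'cV[R]_n) :
    'cV[R]_n :=
  \col_i 'D_(delta_mx i 0) f x.

Definition hess (R : realType) (n : nat) (f : 'cV[R]_n -> R) (x : 'cV[R]_n) :
    'M[R]_n :=
  \matrix_(i, j) 'D_(delta_mx i 0) ('D_(delta_mx j 0) f) x.

Definition third (R : realType) (n : nat) (f : 'cV[R]_n -> R)
    (x u v w : 'cV[R]_n) : R :=
  'D_u ('D_v ('D_w f)) x.

Definition third_vec (R : realType) (n : nat) (f : 'cV[R]_n -> R)
    (x u v : 'cV[R]_n) : 'cV[R]_n :=
  \col_k third f x u v (delta_mx k 0).

(* f is of class C^k on the open set U.  Since f may be arbitrary outside U,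
   continuity and differentiability are required at the points of U only. *)
Fixpoint Ck (R : realType) (V W : normedModType R) (k : nat) (U : set V)
    (f : V -> W) : Prop :=
  if k is k'.+1 then
    (forall x, U x -> differentiable f x) /\ (forall v, Ck k' U ('D_v f))
  else forall x, U x -> {for x, continuous f}.

Definition domain (R : realType) (n : nat) (U : set 'cV[R]_n) : Prop :=
  [/\ open U, connected U & U !=set0].

Definition D1 (R : realType) (n : nat) (W : normedModType R) (v : 'cV[R]_n)
    (f : 'cV[R]_n -> 'cV[R]_n -> W) (x y : 'cV[R]_n) : W :=
  'D_v (fun z => f z y) x.

Definition D2 (R : realType) (n : nat) (W : normedModType R) (v : 'cV[R]_n)
    (f : 'cV[R]_n -> 'cV[R]_n -> W) (x y : 'cV[R]_n) : W :=
  'D_v (fun z => f x z) y.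

Definition grad1 (R : realType) (n : nat) (f : 'cV[R]_n -> 'cV[R]_n -> R)
    (x y : 'cV[R]_n) : 'cV[R]_n :=
  grad (fun z => f z y) x.

Definition grad2 (R : realType) (n : nat) (f : 'cV[R]_n -> 'cV[R]_n -> R)
    (x y : 'cV[R]_n) : 'cV[R]_n :=
  grad (fun z => f x z) y.

(* The transform of a potential on Y; psi may take infinite values. *)
Definition ctransform (R : realType) (n : nat) (c : 'cV[R]_n -> 'cV[R]_n -> R)
    (Y : set 'cV[R]_n) (psi : 'cV[R]_n -> \bar R) (x : 'cV[R]_n) : \bar R :=
  ereal_sup [set ((- c x y)%:E - psi y)%E | y in Y].

Definition cconvex (R : realType) (n : nat) (c : 'cV[R]_n -> 'cV[R]_n -> R)
    (X Y : set 'cV[R]_n) (phi : 'cV[R]_n -> R) : Prop :=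
  exists psi : 'cV[R]_n -> \bar R,
    forall x, X x -> (phi x)%:E = ctransform c Y psi x.

Definition maximizer (R : realType) (n : nat) (c : 'cV[R]_n -> 'cV[R]_n -> R)
    (X : set 'cV[R]_n) (phi : 'cV[R]_n -> R) (y x : 'cV[R]_n) : Prop :=
  X x /\ forall z, X z -> - c z y - phi z <= - c x y - phi x.

Definition argmax_map (R : realType) (n : nat) (c : 'cV[R]_n -> 'cV[R]_n -> R)
    (X : set 'cV[R]_n) (phi : 'cV[R]_n -> R) (y : 'cV[R]_n) : 'cV[R]_n :=
  xget 0 [set x | maximizer c X phi y x].

(* The optimal map is the inverse of y |-> argmax_x (- c x y - phi x). *)
Definition optmap (R : realType) (n : nat) (c : 'cV[R]_n -> 'cV[R]_n -> R)
    (X Y : set 'cV[R]_n) (phi : 'cV[R]_n -> R) : 'cV[R]_n -> 'cV[R]_n :=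
  pinv Y (argmax_map c X phi).

Definition optmap_well_defined (R : realType) (n : nat)
    (c : 'cV[R]_n -> 'cV[R]_n -> R) (X Y : set 'cV[R]_n)
    (phi : 'cV[R]_n -> R) : Prop :=
  (forall y, Y y -> exists! x, maximizer c X phi y x) /\
  set_bij Y X (argmax_map c X phi).

Definition diffeo (R : realType) (n : nat) (X Y : set 'cV[R]_n)
    (T : 'cV[R]_n -> 'cV[R]_n) : Prop :=
  [/\ set_bij X Y T, Ck 1 X T & Ck 1 Y (pinv X T)].

Definition chess (R : realType) (n : nat) (c : 'cV[R]_n -> 'cV[R]_n -> R)
    (T : 'cV[R]_n -> 'cV[R]_n) (phi : 'cV[R]_n -> R) (x u : 'cV[R]_n) :
    'cV[R]_n :=
  D1 u (grad1 c) x (T x) + hess phi x *m u.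

Definition clegendre (R : realType) (n : nat) (c : 'cV[R]_n -> 'cV[R]_n -> R)
    (X Y : set 'cV[R]_n) (phi : 'cV[R]_n -> R) : Prop :=
  let T := optmap c X Y phi in
  [/\ optmap_well_defined c X Y phi, diffeo X Y T &
      forall x, X x -> forall u, u != 0 -> 0 < dot u (chess c T phi x u)].

Definition cdivergence (R : realType) (n : nat) (c : 'cV[R]_n -> 'cV[R]_n -> R)
    (T : 'cV[R]_n -> 'cV[R]_n) (phi : 'cV[R]_n -> R) (x x' : 'cV[R]_n) : R :=
  c x (T x') + phi x - c x' (T x') - phi x'.

(* G is the symmetric operator whose quadratic form is - D'_u D_u F on the
   diagonal; this determines G. *)
Definition divergence_metric (R : realType) (n : nat)
    (F : 'cV[R]_n -> 'cV[R]_n -> R) (x : 'cV[R]_n)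
    (G : 'cV[R]_n -> 'cV[R]_n) : Prop :=
  [/\ linear G,
      forall u v, dot u (G v) = dot v (G u) &
      forall u, dot u (G u) = - D2 u (D1 u F) x x].

Definition mixed1 (R : realType) (n : nat) (F : 'cV[R]_n -> 'cV[R]_n -> R)
    (x u : 'cV[R]_n) : 'cV[R]_n :=
  D1 u (grad2 F) x x.

Definition mixed2 (R : realType) (n : nat) (F : 'cV[R]_n -> 'cV[R]_n -> R)
    (x u : 'cV[R]_n) : 'cV[R]_n :=
  D2 u (grad1 F) x x.

(* [pinv setT A] is the inverse of the operator A when A is bijective. *)
Definition primal_connection (R : realType) (n : nat)
    (F : 'cV[R]_n -> 'cV[R]_n -> R) (x u v : 'cV[R]_n) : 'cV[R]_n :=
  pinv setT (mixed1 F x) (D1 u (D1 v (grad2 F)) x x).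

Definition dual_connection (R : realType) (n : nat)
    (F : 'cV[R]_n -> 'cV[R]_n -> R) (x u v : 'cV[R]_n) : 'cV[R]_n :=
  pinv setT (mixed2 F x) (D2 u (D2 v (grad1 F)) x x).

Definition amari_chentsov (R : realType) (n : nat)
    (c : 'cV[R]_n -> 'cV[R]_n -> R) (T : 'cV[R]_n -> 'cV[R]_n)
    (phi : 'cV[R]_n -> R) (x u v w : 'cV[R]_n) : R :=
  let F := cdivergence c T phi in
  dot w (chess c T phi x (dual_connection F x u v - primal_connection F x u v)).

(* Trilinear and symmetric; the two transpositions generate all permutations,
   and together with linearity in one slot they give it in the others. *)
Definition symmetric_tensor3 (R : realType) (n : nat)
    (C : 'cV[R]_n -> 'cV[R]_n -> 'cV[R]_n -> R) : Prop :=
  [/\ forall v w, scalar (fun u => C u v w),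
      forall u v w, C u v w = C v u w &
      forall u v w, C u v w = C u w v].

Definition arcsinh (R : realType) (t : R) : R :=
  ln (t + Num.sqrt (t ^+ 2 + 1)).

Definition arcsinh_cost (R : realType) (n : nat) (r : R) (x y : 'cV[R]_n) : R :=
  - (arcsinh (r * dot x y) / r).

(* Main.v *)
(* At the optimal pair (x, y = T x), stationarity of z |-> - c z y - phi z gives
   grad phi x = y / sqrt (1 + r^2 (x^T y)^2), hence
   1 - r^2 (x^T grad phi x)^2 = 1 / (1 + r^2 (x^T y)^2) > 0.  This eliminates T
   from the divergence: with g = grad phi x' and
   W = sqrt (r^2 (x^T g)^2 - r^2 (x'^T g)^2 + 1),
     grad_x D = grad phi x - g / W,
     grad_x' D = - (g + h x / W
       + (r^2 (x'^T g) (x^T g) / W - 1) / (1 - r^2 (x'^T g)^2) (g + h x')),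
   and W = 1 on the diagonal, where both mixed derivatives of D become - hess^c.
   Symmetry of the Hessian and of
   the third derivatives is Schwarz's theorem, proved by the mean value theorem on
   a small parallelogram. *)
Require Import Defs.
From mathcomp Require Import all_boot all_order all_algebra.
From mathcomp Require Import all_classical all_reals all_analysis.
From mathcomp Require Import ring.
Import Order.TTheory GRing.Theory Num.Theory.
Import numFieldNormedType.Exports.

Set Implicit Arguments.
Unset Strict Implicit.
Unset Printing Implicit Defensive.

Local Open Scope classical_set_scope.
Local Open Scope ring_scope.

(** * Algebra of the inner product *)

Lemma dotE (R : realType) (n : nat) (u v : 'cV[R]_n) :
  dot u v = \sum_i u i 0 * v i 0.
Proof. by rewrite /dot mxE; apply: eq_bigr => i _; rewrite mxE. Qed.

Lemma dotC (R : realType) (n : nat) (u v : 'cV[R]_n) : dot u v = dot v u.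
Proof. by rewrite !dotE; apply: eq_bigr => i _; rewrite mulrC. Qed.

Lemma dotDr (R : realType) (n : nat) (u v w : 'cV[R]_n) :
  dot u (v + w) = dot u v + dot u w.
Proof. by rewrite /dot mulmxDr mxE. Qed.

Lemma dotZr (R : realType) (n : nat) (u v : 'cV[R]_n) (k : R) :
  dot u (k *: v) = k * dot u v.
Proof. by rewrite /dot -scalemxAr mxE. Qed.

Lemma dotNr (R : realType) (n : nat) (u v : 'cV[R]_n) :
  dot u (- v) = - dot u v.
Proof. by rewrite /dot mulmxN mxE. Qed.

Lemma dot0r (R : realType) (n : nat) (u : 'cV[R]_n) : dot u 0 = 0.
Proof. by rewrite /dot mulmx0 mxE. Qed.

Lemma dotDl (R : realType) (n : nat) (u v w : 'cV[R]_n) :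
  dot (v + w) u = dot v u + dot w u.
Proof. by rewrite dotC dotDr !(dotC u). Qed.

Lemma dotZl (R : realType) (n : nat) (u v : 'cV[R]_n) (k : R) :
  dot (k *: v) u = k * dot v u.
Proof. by rewrite dotC dotZr dotC. Qed.

Lemma dot_delta (R : realType) (n : nat) (i : 'I_n) (v : 'cV[R]_n) :
  dot (delta_mx i 0) v = v i 0.
Proof.
rewrite dotE (bigD1 i)//= big1 ?addr0 => [|j ji]; first by rewrite mxE !eqxx mul1r.
by rewrite mxE (negbTE ji) mul0r.
Qed.

(** Testing against every [w] turns an identity of vectors into one of scalars that [ring] can
    close; the long vector computations below all end this way. *)
Lemma dot_ext (R : realType) (n : nat) (u v : 'cV[R]_n) :
  (forall w, dot w u = dot w v) -> u = v.
Proof. by move=> uv; apply/colP => i; rewrite -!dot_delta. Qed.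

Lemma dot_mulmx (R : realType) (n : nat) (A : 'M[R]_n) (u v : 'cV[R]_n) :
  dot u (A *m v) = dot (A^T *m u) v.
Proof. by rewrite /dot trmx_mul trmxK mulmxA. Qed.

(** * Rules for directional derivatives *)

(** This rule and the next ones are phrased for explicit functions [fun y => ...], so that the
    derivative of a formula is assembled by following its syntax. *)
Lemma is_deriveD_fun (R : realType) (V W : normedModType R) (f k : V -> W)
    (x v : V) (df dk : W) :
  is_derive x v f df -> is_derive x v k dk ->
  is_derive x v (fun y => f y + k y) (df + dk).
Proof. exact: is_deriveD. Qed.

Lemma is_deriveN_fun (R : realType) (V W : normedModType R) (f : V -> W)
    (x v : V) (df : W) :
  is_derive x v f df -> is_derive x v (fun y => - f y) (- df).
Proof. exact: is_deriveN. Qed.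

Lemma is_deriveM_fun (R : realType) (V : normedModType R) (f k : V -> R)
    (x v : V) (df dk : R) :
  is_derive x v f df -> is_derive x v k dk ->
  is_derive x v (fun y => f y * k y) (f x * dk + k x * df).
Proof. exact: is_deriveM. Qed.

Lemma is_deriveX_fun (R : realType) (V : normedModType R) (f : V -> R) (m : nat)
    (x v : V) (df : R) :
  is_derive x v f df ->
  is_derive x v (fun y => f y ^+ m) (m%:R * f x ^+ m.-1 * df).
Proof.
move=> fx; have -> : (fun y => f y ^+ m) = f ^+ m by apply/funext => y; rewrite fctE.
exact: (@is_deriveX _ _ f m x v df fx).
Qed.

(** Both sides have the same difference quotient. This carries one-variable facts (chain rule, mean
    value theorem, vanishing derivative at a maximum) over to directional derivatives. *)
Lemma is_derive_line (R : realType) (V W : normedModType R) (f : V -> W)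
    (x v : V) (t : R) (df : W) :
  is_derive (t *: v + x) v f df <->
  is_derive t 1 (fun h : R => f (h *: v + x)) df.
Proof.
have E : (fun h : R => h^-1 *: ((f \o shift (t *: v + x)) (h *: v)
                                - f (t *: v + x))) =
    (fun h : R => h^-1 *: (((fun h : R => f (h *: v + x)) \o shift t) h%:A
                           - f (t *: v + x))).
  by apply/funext => h /=; rewrite [_%:A]mulr1 scalerDl addrA.
have D : derivable f (t *: v + x) v = derivable (fun h : R => f (h *: v + x)) t 1.
  by rewrite /derivable E.
have d : 'D_v f (t *: v + x) = 'D_1 (fun h : R => f (h *: v + x)) t.
  by rewrite /derive E.
split=> -[d1 d2]; split; first by rewrite -D.
- by rewrite -d.
- by rewrite D.
- by rewrite d.
Qed.

Lemma is_derive_comp (R : realType) (V : normedModType R) (k : R -> R)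
    (f : V -> R) (x v : V) (dk df : R) :
  is_derive x v f df -> is_derive (f x) 1 k dk ->
  is_derive x v (fun y => k (f y)) (dk * df).
Proof.
move=> fx kfx; have e : 0 *: v + x = x by rewrite scale0r add0r.
rewrite -e in kfx fx; suff : is_derive (0 *: v + x) v (k \o f) (dk * df) by rewrite e.
apply/is_derive_line; move/is_derive_line : fx => fx.
exact: (is_derive1_comp kfx fx).
Qed.

(** With q the reciprocal root of f, the derivative is -q^3 df / 2. Keeping q as the basic quantity
    makes all later derivatives polynomial in q. *)
Lemma is_derive_rsqrt (R : realType) (V : normedModType R) (f : V -> R)
    (x v : V) (df : R) :
  is_derive x v f df -> 0 < f x ->
  is_derive x v (fun y => (Num.sqrt (f y))^-1)
    (- (Num.sqrt (f x))^-1 ^+ 3 * df / 2).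
Proof.
move=> dfx fx0; have s0 : Num.sqrt (f x) != 0 by rewrite gt_eqF ?sqrtr_gt0.
have ds := is_derive_comp dfx (is_derive1_sqrt fx0).
split; first by apply: derivableV => //; case: ds.
rewrite deriveV//; case: ds => _ ->.
rewrite -[_ *: _]/(_ * _).
by field.
Qed.

Lemma is_derive_cV (R : realType) (V : normedModType R) (n : nat)
    (f : V -> 'cV[R]_n) (x v : V) (df : 'cV[R]_n) :
  (forall i, is_derive x v (fun y => f y i 0) (df i 0)) ->
  is_derive x v f df.
Proof.
move=> dfi.
have fx : derivable f x v.
  by apply/derivable_mxP => i j; rewrite ord1; case: (dfi i).
split=> //; rewrite derive_mx//; apply/colP => i; rewrite mxE.
by case: (dfi i).
Qed.

Lemma is_derive_coord (R : realType) (V : normedModType R) (n : nat)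
    (f : V -> 'cV[R]_n) (x v : V) (df : 'cV[R]_n) (i : 'I_n) :
  is_derive x v f df -> is_derive x v (fun y => f y i 0) (df i 0).
Proof.
move=> [fx <-]; have /derivable_mxP fxi := fx.
by split; [exact: fxi|rewrite derive_mx// mxE].
Qed.

Lemma is_derive_dot (R : realType) (V : normedModType R) (n : nat)
    (f k : V -> 'cV[R]_n) (x v : V) (df dk : 'cV[R]_n) :
  is_derive x v f df -> is_derive x v k dk ->
  is_derive x v (fun y => dot (f y) (k y)) (dot df (k x) + dot (f x) dk).
Proof.
move=> fx kx.
have -> : (fun y => dot (f y) (k y)) = \sum_i (fun y => f y i 0 * k y i 0).
  by apply/funext => y; rewrite dotE fct_sumE.
rewrite !dotE -big_split/=; apply: is_derive_sum => i.
apply: is_derive_eq.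
  exact: is_deriveM_fun (is_derive_coord i fx) (is_derive_coord i kx).
by rewrite /=; ring.
Qed.

Lemma is_derive_dotl (R : realType) (n : nat) (x v y : 'cV[R]_n) :
  is_derive x v (fun z => dot z y) (dot v y).
Proof.
apply: is_derive_eq.
  exact: (is_derive_dot (is_derive_id x v) (is_derive_cst y x v)).
by rewrite dot0r addr0.
Qed.

Lemma is_derive_dotr (R : realType) (V : normedModType R) (n : nat)
    (w : 'cV[R]_n) (k : V -> 'cV[R]_n) (x v : V) (dk : 'cV[R]_n) :
  is_derive x v k dk -> is_derive x v (fun y => dot w (k y)) (dot w dk).
Proof.
move=> kx; apply: is_derive_eq.
  exact: (is_derive_dot (is_derive_cst w x v) kx).
by rewrite dotC dot0r add0r.
Qed.

Lemma is_deriveZ_fun (R : realType) (V : normedModType R) (n : nat)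
    (f : V -> R) (k : V -> 'cV[R]_n) (x v : V) (df : R) (dk : 'cV[R]_n) :
  is_derive x v f df -> is_derive x v k dk ->
  is_derive x v (fun y => f y *: k y) (df *: k x + f x *: dk).
Proof.
move=> fx kx; apply: is_derive_cV => i.
have -> : (fun y => (f y *: k y) i 0) = (fun y => f y * k y i 0).
  by apply/funext => y; rewrite mxE.
apply: is_derive_eq; first exact: is_deriveM_fun fx (is_derive_coord i kx).
by rewrite !mxE; ring.
Qed.

Lemma is_derive_mulmx (R : realType) (V : normedModType R) (n : nat)
    (A : 'M[R]_n) (k : V -> 'cV[R]_n) (x v : V) (dk : 'cV[R]_n) :
  is_derive x v k dk -> is_derive x v (fun y => A *m k y) (A *m dk).
Proof.
move=> kx; apply: is_derive_cV => i.
have E z : (A *m z) i 0 = dot (row i A)^T z by rewrite /dot trmxK -row_mul [RHS]mxE.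
under eq_fun do rewrite E.
by rewrite E; exact: is_derive_dotr.
Qed.

(** * Schwarz's theorem *)

Lemma is_derive_line0 (R : realType) (V W : normedModType R) (f : V -> W)
    (x v : V) (t : R) (df : W) :
  is_derive (x + t *: v) v f df ->
  is_derive t 1 (fun h : R => f (x + h *: v)) df.
Proof.
rewrite addrC => /is_derive_line.
by under eq_fun do rewrite addrC.
Qed.

Lemma derivable_oo_MVT (R : realType) (f df : R -> R) (s : R) :
  0 < s -> (forall t, 0 <= t <= s -> is_derive t 1 f (df t)) ->
  exists2 t, 0 <= t <= s & f s - f 0 = df t * s.
Proof.
move=> s0 dfE; have [||t] := @MVT _ f df _ _ s0.
- by move=> t; rewrite in_itv/= => /andP[/ltW a /ltW b]; apply: dfE; rewrite a.
- apply: continuous_in_subspaceT => t; rewrite inE /= in_itv /= => /dfE[dt _].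
  exact/differentiable_continuous/derivable1_diffP.
rewrite in_itv/= subr0 => /andP[/ltW a /ltW b] E.
by exists t; rewrite ?a.
Qed.

(** The mean value theorem is applied twice: along u to the increment of f in direction v, which
    produces a, then along v to ['D_u f], which produces b. *)
Lemma rectangle_mean_value (R : realType) (V : normedModType R) (f : V -> R)
    (U : set V) (x u v : V) (s : R) :
  Ck 2 U f -> 0 < s ->
  (forall a b : R, 0 <= a <= s -> 0 <= b <= s -> U (x + a *: u + b *: v)) ->
  exists a b, [/\ 0 <= a <= s, 0 <= b <= s &
    f (x + s *: u + s *: v) - f (x + s *: u) - (f (x + s *: v) - f x) =
    'D_v ('D_u f) (x + a *: u + b *: v) * s * s].
Proof.
move=> [df /(_ u)[d2f _]] s0 Us.
have ss : 0 <= s <= s by rewrite lexx ltW.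
have zs : (0 : R) <= 0 <= s by rewrite lexx ltW.
have [|a as_ Ea] := @derivable_oo_MVT _
    (fun t => f (x + s *: v + t *: u) - f (x + t *: u))
    (fun t => 'D_u f (x + s *: v + t *: u) - 'D_u f (x + t *: u)) _ s0.
  move=> t ts; apply: is_deriveD_fun; last apply: is_deriveN_fun;
    apply: (is_derive_line0 (f := f)); apply: derivableP; apply: diff_derivable;
    apply: df.
    by rewrite addrAC; exact: Us.
  by have := Us _ _ ts zs; rewrite scale0r addr0.
have [|b bs Eb] := @derivable_oo_MVT _
    (fun t => 'D_u f (x + a *: u + t *: v))
    (fun t => 'D_v ('D_u f) (x + a *: u + t *: v)) _ s0.
  move=> t ts; apply: (is_derive_line0 (f := 'D_u f)).
  apply: derivableP; apply: diff_derivable.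
  by apply: d2f; exact: Us.
exists a, b; split=> //; move: Ea Eb; rewrite !scale0r !addr0.
by rewrite ![x + s *: v + _]addrAC => -> <-.
Qed.

(** One second difference over a parallelogram of scale s equals s^2 times either mixed derivative,
    each taken at some point of the parallelogram. For small s, continuity puts both values within
    e/2 of those at x. *)
Lemma derive_swap (R : realType) (V : normedModType R) (f : V -> R)
    (U : set V) (x u v : V) :
  open U -> Ck 2 U f -> U x -> 'D_u ('D_v f) x = 'D_v ('D_u f) x.
Proof.
move=> oU C2 Ux; apply/eqP; rewrite -subr_eq0 -normr_le0; apply/ler_addgt0Pl => e e0.
rewrite addr0.
have near_diff (p m q : R) :
    `|p - m| < e / 2 -> `|m - q| < e / 2 -> `|p - q| <= e.
  move=> pm mq; rewrite (le_trans (ler_distD m _ _))// (splitr e).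
  by rewrite lerD// ltW.
have e2 : 0 < e / 2 by rewrite divr_gt0.
have cP : {for x, continuous ('D_u ('D_v f))} by case: C2 => _ /(_ v)[_ /(_ u)]; apply.
have cQ : {for x, continuous ('D_v ('D_u f))} by case: C2 => _ /(_ u)[_ /(_ v)]; apply.
have nU : \forall z \near x, U z by apply: open_nbhs_nbhs.
move/cvgrPdist_lt : cP => /(_ _ e2) nP; move/cvgrPdist_lt : cQ => /(_ _ e2) nQ.
have [d /= d0 dB] := (nbhs_normP _ _).1 (filterI nU (filterI nP nQ)).
(* With this s the parallelogram stays within distance d/2 of x, hence strictly inside the ball of
   radius d; the summand 1 keeps the denominator positive when u = v = 0. *)
pose s := d / 2 / (`|u| + `|v| + 1).
have uv0 : 0 < `|u| + `|v| + 1 by rewrite ltr_wpDl// addr_ge0.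
have s0 : 0 < s by rewrite !divr_gt0.
have inB a b : 0 <= a <= s -> 0 <= b <= s -> `|x - (x + a *: u + b *: v)| < d.
  move=> /andP[a0 as_] /andP[b0 bs]; rewrite -addrA opprD addNKr normrN.
  apply: (@le_lt_trans _ _ (d / 2)); last by rewrite ltr_pdivrMr// ltr_pMr// ltr1n.
  rewrite (le_trans (ler_normD _ _))// !normrZ !ger0_norm//.
  have -> : d / 2 = s * (`|u| + `|v| + 1) by rewrite divfK// gt_eqF.
  by rewrite mulrDr mulr1 mulrDr ler_wpDr// ?(ltW s0)// lerD// ler_wpM2r.
have [|a [b [as_ bs E1]]] := @rectangle_mean_value _ _ f U x u v s C2 s0.
  by move=> a b as_ bs; have [] := dB _ (inB _ _ as_ bs).
(* The same second difference with the roles of u and v exchanged. *)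
have [|b' [a' [bs' as' E2]]] := @rectangle_mean_value _ _ f U x v u s C2 s0.
  by move=> a' b' as' bs'; rewrite addrAC; have [] := dB _ (inB _ _ bs' as').
have sn0 : s != 0 by rewrite gt_eqF.
have {E1 E2} E : 'D_v ('D_u f) (x + a *: u + b *: v) * s * s =
    'D_u ('D_v f) (x + b' *: v + a' *: u) * s * s.
  apply: etrans (esym E1) (etrans _ E2).
  by rewrite [x + s *: v + _]addrAC; ring.
move/(mulIf sn0)/(mulIf sn0) : E => E.
have hQ : `|'D_v ('D_u f) x - 'D_v ('D_u f) (x + a *: u + b *: v)| < e / 2.
  by have [_ [_]] := dB _ (inB _ _ as_ bs).
have hP : `|'D_u ('D_v f) x - 'D_u ('D_v f) (x + b' *: v + a' *: u)| < e / 2.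
  have bd : `|x - (x + b' *: v + a' *: u)| < d by rewrite addrAC; exact: inB.
  by have [_ [+ _]] := dB _ bd.
rewrite E distrC in hQ.
exact: near_diff hP hQ.
Qed.

(** * Gradient, Hessian and third derivatives *)

Lemma derive_linear (R : realType) (V : normedModType R) (f : V -> R) (x : V) :
  differentiable f x -> scalar (fun v => 'D_v f x).
Proof. by move=> dfx a u v; rewrite !deriveE// linearP. Qed.

Lemma derive_grad (R : realType) (n : nat) (f : 'cV[R]_n -> R)
    (x v : 'cV[R]_n) :
  differentiable f x -> 'D_v f x = dot v (grad f x).
Proof.
move=> dfx; rewrite deriveE// dotE.
have {1}-> : v = \sum_i v i 0 *: delta_mx i 0.
  apply/colP => j; rewrite summxE (bigD1 j)//= big1 => [|i ij].
    by rewrite addr0 !mxE !eqxx mulr1.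
  by rewrite !mxE eq_sym (negbTE ij) mulr0.
rewrite linear_sum; apply: eq_bigr => i _.
by rewrite linearZ mxE deriveE.
Qed.

(** Row i of [hess] differentiates along the i-th basis vector last, so Schwarz's theorem is what
    lets the derivative along v be the outer one. *)
Lemma hess_mulmxE (R : realType) (n : nat) (U : set 'cV[R]_n)
    (f : 'cV[R]_n -> R) (x v : 'cV[R]_n) (i : 'I_n) :
  open U -> Ck 2 U f -> U x ->
  (hess f x *m v) i 0 = 'D_v ('D_(delta_mx i 0) f) x.
Proof.
move=> oU C2 Ux; rewrite mxE derive_grad; last first.
  by case: C2 => _ /(_ (delta_mx i 0))[+ _]; apply.
rewrite dotE; apply: eq_bigr => j _; rewrite !mxE mulrC.
by rewrite (derive_swap _ _ oU C2 Ux).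
Qed.

Lemma is_derive_grad (R : realType) (n : nat) (U : set 'cV[R]_n)
    (f : 'cV[R]_n -> R) (x v : 'cV[R]_n) :
  open U -> Ck 2 U f -> U x -> is_derive x v (grad f) (hess f x *m v).
Proof.
move=> oU C2 Ux; apply: is_derive_cV => i.
under eq_fun do rewrite mxE.
rewrite (hess_mulmxE _ _ oU C2 Ux); apply: derivableP; apply: diff_derivable.
by case: C2 => _ /(_ (delta_mx i 0))[+ _]; apply.
Qed.

Lemma dot_hessC (R : realType) (n : nat) (U : set 'cV[R]_n)
    (f : 'cV[R]_n -> R) (x u v : 'cV[R]_n) :
  open U -> Ck 2 U f -> U x ->
  dot u (hess f x *m v) = dot v (hess f x *m u).
Proof.
move=> oU C2 Ux; rewrite dot_mulmx dotC; congr (dot _ (_ *m _)).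
by apply/matrixP => i j; rewrite !mxE (derive_swap _ _ oU C2 Ux).
Qed.

Lemma Ck_le (R : realType) (V W : normedModType R) (k : nat) (U : set V)
    (f : V -> W) : Ck k.+1 U f -> Ck k U f.
Proof.
elim: k f => [|k IH] f [df Df].
  by move=> x Ux; exact/differentiable_continuous/df.
by split=> // v; exact: IH.
Qed.

Lemma is_derive_hess (R : realType) (n : nat) (U : set 'cV[R]_n)
    (f : 'cV[R]_n -> R) (x u v : 'cV[R]_n) :
  open U -> Ck 3 U f -> U x ->
  is_derive x u (fun y => hess f y *m v) (third_vec f x u v).
Proof.
move=> oU C3 Ux; apply: is_derive_cV => i; rewrite mxE.
apply: (@near_eq_is_derive _ _ _ ('D_v ('D_(delta_mx i 0) f))).
  have : \forall y \near x, U y by apply: open_nbhs_nbhs.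
  by apply: filterS => y Uy; rewrite (hess_mulmxE _ _ oU (Ck_le C3) Uy).
apply: derivableP; apply: diff_derivable.
by case: C3 => _ /(_ (delta_mx i 0))[_ /(_ v)[+ _]]; apply.
Qed.

(** [third_vec] is built from its coordinates; this shows that it represents the third derivative in
    every direction w. Near x, ['D_v ('D_w f)] is the pairing of w with [hess f *m v], and that
    pairing is differentiated along u. *)
Lemma third_grad (R : realType) (n : nat) (U : set 'cV[R]_n)
    (f : 'cV[R]_n -> R) (x u v w : 'cV[R]_n) :
  open U -> Ck 3 U f -> U x -> third f x u v w = dot w (third_vec f x u v).
Proof.
move=> oU C3 Ux; have nU y : U y -> \forall z \near y, U z.
  by move=> Uy; apply: open_nbhs_nbhs.
have C2 := Ck_le C3.
have E y : U y -> 'D_v ('D_w f) y = dot w (hess f y *m v).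
  move=> Uy; rewrite (@near_eq_derive _ _ _ _ (fun z => dot w (grad f z))).
    by have [_ ->] := is_derive_dotr w (is_derive_grad v oU C2 Uy).
  apply: filterS (nU _ Uy) => z Uz; rewrite derive_grad//.
  by case: C2 => + _; apply.
rewrite /third (@near_eq_derive _ _ _ _ (fun z => dot w (hess f z *m v))).
  by have [_ ->] := is_derive_dotr w (is_derive_hess u v oU C3 Ux).
by apply: filterS (nU _ Ux) => z Uz; exact: E.
Qed.

Lemma thirdCl (R : realType) (n : nat) (U : set 'cV[R]_n)
    (f : 'cV[R]_n -> R) (x u v w : 'cV[R]_n) :
  open U -> Ck 3 U f -> U x -> third f x u v w = third f x v u w.
Proof. by move=> oU [_ /(_ w) C2] Ux; exact: derive_swap oU C2 Ux. Qed.

(** Here the two inner derivatives are exchanged, so Schwarz's theorem is needed on a neighbourhood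
    of x before differentiating along u; in [thirdCl] it is applied to ['D_w f] at x alone. *)
Lemma thirdCr (R : realType) (n : nat) (U : set 'cV[R]_n)
    (f : 'cV[R]_n -> R) (x u v w : 'cV[R]_n) :
  open U -> Ck 3 U f -> U x -> third f x u v w = third f x u w v.
Proof.
move=> oU C3 Ux; apply: near_eq_derive.
have : \forall y \near x, U y by apply: open_nbhs_nbhs.
by apply: filterS => y Uy; exact: derive_swap oU (Ck_le C3) Uy.
Qed.

Lemma third_linear (R : realType) (n : nat) (U : set 'cV[R]_n)
    (f : 'cV[R]_n -> R) (x v w : 'cV[R]_n) :
  Ck 3 U f -> U x -> scalar (fun u => third f x u v w).
Proof.
move=> [_ /(_ w)[_ /(_ v)[dvw _]]] Ux; apply: derive_linear; exact: dvw.
Qed.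

(** * Interior maxima, and derivatives of the arcsinh cost *)

(** Restricting f to the line through x in direction v reduces the claim to one variable, on an
    interval short enough for the segment to stay in U. *)
Lemma derive_at_max (R : realType) (V : normedModType R) (f : V -> R)
    (U : set V) (x v : V) :
  open U -> U x -> (forall y, U y -> derivable f y v) ->
  (forall y, U y -> f y <= f x) -> 'D_v f x = 0.
Proof.
move=> oU Ux df fmax.
have nU : \forall y \near x, U y by apply: open_nbhs_nbhs.
have [d /= d0 dB] := (nbhs_normP _ _).1 nU.
pose e := d / (`|v| + 1).
have v0 : 0 < `|v| + 1 by rewrite ltr_wpDl.
have e0 : 0 < e by rewrite divr_gt0.
have Ut (t : R) : t \in `]- e, e[ -> U (t *: v + x).
  rewrite in_itv/= -ltr_norml => te; apply: dB => /=.
  rewrite opprD addrC -addrA addNr addr0 normrN normrZ.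
  have -> : d = e * (`|v| + 1) by rewrite divfK// gt_eqF.
  by rewrite mulrDr mulr1 ltr_pwDr// ler_wpM2r// ltW.
have dline (t : R) : t \in `]- e, e[ -> is_derive t 1 (fun h : R => f (h *: v + x))
    ('D_v f (t *: v + x)).
  move=> te; apply: (is_derive_line f x v t _).1; apply: derivableP.
  exact: df (Ut t te).
have z0 : 0 \in `]- e, e[ by rewrite in_itv/= oppr_lt0 e0.
have [|t te|//|t te|_] := @derive1_at_max _ (fun h : R => f (h *: v + x)) (- e) e 0.
- by rewrite ge0_cp// ltW.
- by case: (dline t te).
- by rewrite scale0r add0r; exact/fmax/Ut.
by have [_ ->] := dline 0 z0; rewrite scale0r add0r.
Qed.

Lemma sqr_succ_gt0 (R : realType) (t : R) : 0 < t ^+ 2 + 1.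
Proof. by rewrite ltr_wpDl// sqr_ge0. Qed.

(** The root exceeds |t|, being larger than the root of t^2. *)
Lemma arcsinh_arg_gt0 (R : realType) (t : R) : 0 < t + Num.sqrt (t ^+ 2 + 1).
Proof.
rewrite -ltrBlDl sub0r (le_lt_trans (ler_norm _))// normrN -sqrtr_sqr.
by rewrite ltr_sqrt ?sqr_succ_gt0// ltrDl.
Qed.

Lemma is_derive_arcsinh (R : realType) (t : R) :
  is_derive t 1 (@arcsinh R) (Num.sqrt (t ^+ 2 + 1))^-1.
Proof.
have s0 := sqr_succ_gt0 t; have a0 := arcsinh_arg_gt0 t.
have ds : is_derive t 1 (fun t => t + Num.sqrt (t ^+ 2 + 1))
    (1 + (2 * Num.sqrt (t ^+ 2 + 1))^-1 * (2%:R * t ^+ 1 * 1 + 0)).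
  apply: is_deriveD_fun.
  have dt : is_derive t 1 (fun t : R => t ^+ 2 + 1) (2%:R * t ^+ 1 * 1 + 0).
    by apply: is_deriveD_fun; apply: is_deriveX_fun.
  exact: is_derive_comp dt (is_derive1_sqrt s0).
apply: is_derive_eq; first exact: (is_derive_comp ds (is_derive1_ln a0)).
have : Num.sqrt (t ^+ 2 + 1) != 0 by rewrite gt_eqF ?sqrtr_gt0.
move: a0 => /lt0r_neq0; move: (Num.sqrt _) => s ts0 sn0.
by field; rewrite sn0 ts0.
Qed.

Lemma is_derive_cost (R : realType) (n : nat) (r : R) (x v y : 'cV[R]_n) :
  0 < r ->
  is_derive x v (fun z => arcsinh_cost r z y)
    (- ((Num.sqrt ((r * dot x y) ^+ 2 + 1))^-1 * dot v y)).
Proof.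
move=> /lt0r_neq0 r0; rewrite /arcsinh_cost; apply: is_deriveN_fun.
have dxy : is_derive x v (fun z => r * dot z y) (r * dot v y + dot x y * 0).
  apply: is_deriveM_fun; exact: is_derive_dotl.
apply: is_derive_eq.
  apply: is_deriveM_fun; exact: is_derive_comp dxy (is_derive_arcsinh _).
have : Num.sqrt ((r * dot x y) ^+ 2 + 1) != 0.
  by rewrite gt_eqF ?sqrtr_gt0 ?sqr_succ_gt0.
by move: (Num.sqrt _) => s sn0; field; rewrite sn0 r0.
Qed.

Lemma grad1_cost (R : realType) (n : nat) (r : R) (x y : 'cV[R]_n) :
  0 < r ->
  grad1 (arcsinh_cost r) x y =
  - ((Num.sqrt ((r * dot x y) ^+ 2 + 1))^-1 *: y).
Proof.
move=> r0; apply/colP => i; rewrite !mxE.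
by have [_ ->] := is_derive_cost x (delta_mx i 0) y r0; rewrite dot_delta.
Qed.

Lemma is_derive_grad1_cost (R : realType) (n : nat) (r : R)
    (x u y : 'cV[R]_n) : 0 < r ->
  is_derive x u (fun z => grad1 (arcsinh_cost r) z y)
    ((r ^+ 2 * (Num.sqrt ((r * dot x y) ^+ 2 + 1))^-1 ^+ 3
      * dot x y * dot u y) *: y).
Proof.
move=> r0; under eq_fun do rewrite grad1_cost//.
have dxy : is_derive x u (fun z => (r * dot z y) ^+ 2 + 1)
    (2%:R * (r * dot x y) ^+ 1 * (r * dot u y + dot x y * 0) + 0).
  apply: is_deriveD_fun; apply: is_deriveX_fun; apply: is_deriveM_fun.
  exact: is_derive_dotl.
apply: is_derive_eq.
  apply: is_deriveN_fun; apply: is_deriveZ_fun.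
  exact: is_derive_rsqrt dxy (sqr_succ_gt0 _).
rewrite scaler0 addr0 -scaleNr /=; congr (_ *: _).
by move: (Num.sqrt _)^-1 => q; field.
Qed.

(** * The optimal map and its first-order condition *)

(** [argmax_map] maps Y onto X, so it sends [optmap c X Y phi x] back to x; and its value at a point
    of Y is a maximizer, since one exists there. *)
Lemma optmap_maximizer (R : realType) (n : nat) (c : 'cV[R]_n -> 'cV[R]_n -> R)
    (X Y : set 'cV[R]_n) (phi : 'cV[R]_n -> R) (x : 'cV[R]_n) :
  optmap_well_defined c X Y phi -> X x ->
  maximizer c X phi (optmap c X Y phi x) x.
Proof.
move=> [max1 bij] Xx; have [_ _ surj] := bij.
have Tx : Y (optmap c X Y phi x).
  by have [pinv_fun _ _] := bijpinv_bij (fun=> point) bij; exact: pinv_fun.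
have {2}<- : argmax_map c X phi (optmap c X Y phi x) = x.
  by apply: (surjpK _ surj); rewrite inE.
by apply: xgetPex; have [z [zmax _]] := max1 _ Tx; exists z.
Qed.

(** The point x maximizes z |-> - c z y - phi z over the open set X, so all partial derivatives of
    this function vanish at x. *)
Lemma grad_optmap (R : realType) (n : nat) (r : R) (X Y : set 'cV[R]_n)
    (phi : 'cV[R]_n -> R) (x : 'cV[R]_n) :
  let y := optmap (arcsinh_cost r) X Y phi x in
  0 < r -> open X -> (forall z, X z -> differentiable phi z) ->
  optmap_well_defined (arcsinh_cost r) X Y phi -> X x ->
  grad phi x = (Num.sqrt ((r * dot x y) ^+ 2 + 1))^-1 *: y.
Proof.
move=> y r0 oX dphi wd Xx; apply/colP => i; rewrite !mxE.
set v := delta_mx i 0; rewrite -[y i 0]dot_delta -/v.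
have [_ ymax] := optmap_maximizer wd Xx.
have df z : X z -> is_derive z v (fun z => - arcsinh_cost r z y - phi z)
    (- - ((Num.sqrt ((r * dot z y) ^+ 2 + 1))^-1 * dot v y) - 'D_v phi z).
  move=> Xz; apply: is_deriveD_fun; apply: is_deriveN_fun.
    exact: is_derive_cost.
  by apply: derivableP; apply: diff_derivable; apply: dphi.
have := derive_at_max oX Xx (fun z Xz => @ex_derive _ _ _ _ _ _ _ (df z Xz)) ymax.
have [_ ->] := df x Xx; rewrite opprK => /eqP; rewrite subr_eq0.
by move/eqP <-.
Qed.

(** * Elimination of the optimal map from the divergence *)

Definition radicand (R : realType) (n : nat) (r : R) (phi : 'cV[R]_n -> R)
    (x x' : 'cV[R]_n) : R :=
  r ^+ 2 * dot x (grad phi x') ^+ 2 - r ^+ 2 * dot x' (grad phi x') ^+ 2 + 1.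

(** This is 1/W, the only irrational quantity in the derivatives of the divergence, and it equals 1
    on the diagonal. *)
Definition rsqrt_radicand (R : realType) (n : nat) (r : R)
    (phi : 'cV[R]_n -> R) (x x' : 'cV[R]_n) : R :=
  (Num.sqrt (radicand r phi x x'))^-1.

Lemma radicand_diag (R : realType) (n : nat) (r : R) (phi : 'cV[R]_n -> R)
    (x : 'cV[R]_n) : radicand r phi x x = 1.
Proof. by rewrite /radicand subrr add0r. Qed.

Lemma rsqrt_radicand_diag (R : realType) (n : nat) (r : R)
    (phi : 'cV[R]_n -> R) (x : 'cV[R]_n) : rsqrt_radicand r phi x x = 1.
Proof. by rewrite /rsqrt_radicand radicand_diag sqrtr1 invr1. Qed.

(* First-order optimality [D c(x, y) + g = 0] at [y = T x], with [g] the gradient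
   of the potential at [x]. *)
Definition c_dual (R : realType) (n : nat) (r : R) (g x y : 'cV[R]_n) : Prop :=
  g = (Num.sqrt ((r * dot x y) ^+ 2 + 1))^-1 *: y.

(** Write s for the root, so that g = y / s and s^2 = 1 + r^2 (x^T y)^2. Then 1 - r^2 (x^T g)^2 =
    (s^2 - r^2 (x^T y)^2) / s^2 = 1 / s^2. *)
Lemma sqr_dual_scale (R : realType) (n : nat) (r : R) (g x y : 'cV[R]_n) :
  c_dual r g x y ->
  (Num.sqrt ((r * dot x y) ^+ 2 + 1))^-1 ^+ 2 = 1 - r ^+ 2 * dot x g ^+ 2.
Proof.
move=> ->; rewrite dotZr; have s0 := sqr_succ_gt0 (r * dot x y).
have : Num.sqrt ((r * dot x y) ^+ 2 + 1) != 0 by rewrite gt_eqF ?sqrtr_gt0.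
have := sqr_sqrtr (ltW s0); move: (Num.sqrt _) => s s2 sn0.
apply: (mulIf (expf_neq0 2 sn0)); rewrite mulrBl.
have -> : r ^+ 2 * (s^-1 * dot x y) ^+ 2 * s ^+ 2 = (r * dot x y) ^+ 2 by field.
by rewrite -exprMn mulVf// expr1n s2; ring.
Qed.

(** The constant part 1 - r^2 (x^T g)^2 is 1 / s^2 by [sqr_dual_scale], and z^T g = z^T y / s; the
    factor 1 / s^2 comes out. In particular the radicand is positive for every z. *)
Lemma radicand_dual (R : realType) (n : nat) (r : R) (phi : 'cV[R]_n -> R)
    (z x y : 'cV[R]_n) : c_dual r (grad phi x) x y ->
  radicand r phi z x =
  (Num.sqrt ((r * dot x y) ^+ 2 + 1))^-1 ^+ 2 * ((r * dot z y) ^+ 2 + 1).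
Proof.
move=> gE; rewrite /radicand addrAC -addrA -(sqr_dual_scale gE) {1}gE dotZr.
ring.
Qed.

Lemma radicand_gt0 (R : realType) (n : nat) (r : R) (phi : 'cV[R]_n -> R)
    (z x y : 'cV[R]_n) :
  c_dual r (grad phi x) x y -> 0 < radicand r phi z x.
Proof.
move=> /radicand_dual ->; rewrite mulr_gt0 ?exprn_gt0 ?invr_gt0 ?sqrtr_gt0//;
  exact: sqr_succ_gt0.
Qed.

Lemma sqrt_radicand_dual (R : realType) (n : nat) (r : R)
    (phi : 'cV[R]_n -> R) (z x y : 'cV[R]_n) :
  c_dual r (grad phi x) x y ->
  Num.sqrt (radicand r phi z x) =
  (Num.sqrt ((r * dot x y) ^+ 2 + 1))^-1 * Num.sqrt ((r * dot z y) ^+ 2 + 1).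
Proof.
move=> /radicand_dual ->; rewrite sqrtrM ?sqr_ge0// sqrtr_sqr ger0_norm//.
Qed.

(** Up to sign, the left side is the gradient of the cost at (z, y); the right side expresses it
    through the gradient of phi. *)
Lemma rsqrt_radicand_dual (R : realType) (n : nat) (r : R)
    (phi : 'cV[R]_n -> R) (z x y : 'cV[R]_n) :
  c_dual r (grad phi x) x y ->
  (Num.sqrt ((r * dot z y) ^+ 2 + 1))^-1 *: y =
  rsqrt_radicand r phi z x *: grad phi x.
Proof.
move=> gE; rewrite /rsqrt_radicand (sqrt_radicand_dual z gE) gE scalerA.
have : Num.sqrt ((r * dot x y) ^+ 2 + 1) != 0.
  by rewrite gt_eqF ?sqrtr_gt0 ?sqr_succ_gt0.
by rewrite invfM invrK => s0; rewrite mulrAC mulfV// mul1r.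
Qed.

Lemma logarg_dual (R : realType) (n : nat) (r : R) (phi : 'cV[R]_n -> R)
    (z x y : 'cV[R]_n) : c_dual r (grad phi x) x y ->
  r * dot z (grad phi x) + Num.sqrt (radicand r phi z x) =
  (Num.sqrt ((r * dot x y) ^+ 2 + 1))^-1
  * (r * dot z y + Num.sqrt ((r * dot z y) ^+ 2 + 1)).
Proof.
move=> gE; rewrite (sqrt_radicand_dual z gE) mulrDr {1}gE dotZr.
by rewrite mulrCA.
Qed.

Lemma logarg_gt0 (R : realType) (n : nat) (r : R) (phi : 'cV[R]_n -> R)
    (z x y : 'cV[R]_n) : c_dual r (grad phi x) x y ->
  0 < r * dot z (grad phi x) + Num.sqrt (radicand r phi z x).
Proof.
move=> gE; rewrite (logarg_dual z gE) mulr_gt0 ?arcsinh_arg_gt0//.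
by rewrite invr_gt0 sqrtr_gt0 sqr_succ_gt0.
Qed.

(** Both logarithms on the right have arguments equal to those of arcsinh times the same factor 1 /
    s, by [logarg_dual] at z and at x, so the factor cancels in the difference. *)
Lemma arcsinhB_dual (R : realType) (n : nat) (r : R) (phi : 'cV[R]_n -> R)
    (z x y : 'cV[R]_n) : c_dual r (grad phi x) x y ->
  arcsinh (r * dot z y) - arcsinh (r * dot x y) =
  ln (r * dot z (grad phi x) + Num.sqrt (radicand r phi z x))
  - ln (r * dot x (grad phi x) + 1).
Proof.
move=> gE; have := logarg_dual x gE; rewrite radicand_diag sqrtr1 => ->.
rewrite (logarg_dual z gE).
have s0 : 0 < (Num.sqrt ((r * dot x y) ^+ 2 + 1))^-1.
  by rewrite invr_gt0 sqrtr_gt0 sqr_succ_gt0.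
rewrite !lnM ?posrE ?arcsinh_arg_gt0// /arcsinh; ring.
Qed.

Lemma cdivergenceE (R : realType) (n : nat) (r : R)
    (T : 'cV[R]_n -> 'cV[R]_n) (phi : 'cV[R]_n -> R) (x x' : 'cV[R]_n) :
  c_dual r (grad phi x') x' (T x') ->
  cdivergence (arcsinh_cost r) T phi x x' =
  phi x - phi x'
  - r^-1 * (ln (r * dot x (grad phi x') + Num.sqrt (radicand r phi x x'))
            - ln (r * dot x' (grad phi x') + 1)).
Proof.
move=> /arcsinhB_dual <-; rewrite /cdivergence /arcsinh_cost; ring.
Qed.

(** * Gradients of the divergence in each variable *)

(** In the first variable [T x'] is constant, so the defining formula is differentiated directly and
    the cost gradient is then rewritten by [rsqrt_radicand_dual]. *)
Lemma is_derive_cdivergence1 (R : realType) (n : nat) (r : R)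
    (T : 'cV[R]_n -> 'cV[R]_n) (phi : 'cV[R]_n -> R) (x x' v : 'cV[R]_n) :
  0 < r -> c_dual r (grad phi x') x' (T x') -> differentiable phi x ->
  is_derive x v (fun z => cdivergence (arcsinh_cost r) T phi z x')
    (dot v (grad phi x - rsqrt_radicand r phi x x' *: grad phi x')).
Proof.
move=> r0 gE dphi; rewrite /cdivergence -(rsqrt_radicand_dual x gE).
apply: is_derive_eq.
  apply: is_deriveD_fun.
  apply: is_deriveD_fun; apply: is_deriveD_fun.
    exact: is_derive_cost.
  by apply: derivableP; apply: diff_derivable.
rewrite /= !addr0 derive_grad// dotDr dotNr dotZr addrC//.
Qed.

Lemma grad1_cdivergence (R : realType) (n : nat) (r : R)
    (T : 'cV[R]_n -> 'cV[R]_n) (phi : 'cV[R]_n -> R) (x x' : 'cV[R]_n) :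
  0 < r -> c_dual r (grad phi x') x' (T x') -> differentiable phi x ->
  grad1 (cdivergence (arcsinh_cost r) T phi) x x' =
  grad phi x - rsqrt_radicand r phi x x' *: grad phi x'.
Proof.
move=> r0 gE dphi; apply/colP => i; rewrite mxE.
by have [_ ->] := is_derive_cdivergence1 (delta_mx i 0) r0 gE dphi; rewrite dot_delta.
Qed.

Lemma is_derive_radicand1 (R : realType) (n : nat) (r : R)
    (phi : 'cV[R]_n -> R) (x x' v : 'cV[R]_n) :
  is_derive x v (fun z => radicand r phi z x')
    (2 * r ^+ 2 * (dot x (grad phi x') * dot v (grad phi x'))).
Proof.
rewrite /radicand; apply: is_derive_eq.
  apply: is_deriveD_fun; apply: is_deriveD_fun; apply: is_deriveM_fun.
  by apply: is_deriveX_fun; exact: is_derive_dotl.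
by rewrite /=; ring.
Qed.

Lemma is_derive_radicand2 (R : realType) (n : nat) (r : R)
    (U : set 'cV[R]_n) (phi : 'cV[R]_n -> R) (x x' v : 'cV[R]_n) :
  open U -> Ck 2 U phi -> U x' ->
  is_derive x' v (fun y => radicand r phi x y)
    (2 * r ^+ 2 * (dot x (grad phi x') * dot x (hess phi x' *m v)
       - dot x' (grad phi x')
         * (dot v (grad phi x') + dot x' (hess phi x' *m v)))).
Proof.
move=> oU C2 Ux'; have dg := is_derive_grad v oU C2 Ux'.
rewrite /radicand; apply: is_derive_eq.
  apply: is_deriveD_fun; apply: is_deriveD_fun.
    apply: is_deriveM_fun; apply: is_deriveX_fun; exact: is_derive_dotr dg.
  apply: is_deriveN_fun; apply: is_deriveM_fun; apply: is_deriveX_fun.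
  exact: is_derive_dot (is_derive_id x' v) dg.
by rewrite /=; ring.
Qed.

Lemma is_derive_rsqrt_radicand1 (R : realType) (n : nat) (r : R)
    (phi : 'cV[R]_n -> R) (x x' y v : 'cV[R]_n) :
  c_dual r (grad phi x') x' y ->
  is_derive x v (fun z => rsqrt_radicand r phi z x')
    (- (r ^+ 2 * rsqrt_radicand r phi x x' ^+ 3
        * (dot x (grad phi x') * dot v (grad phi x')))).
Proof.
move=> gE; apply: is_derive_eq.
  exact: is_derive_rsqrt (is_derive_radicand1 _ _ _ _ _) (radicand_gt0 x gE).
by rewrite -/(rsqrt_radicand r phi x x'); field.
Qed.

Lemma is_derive_rsqrt_radicand2 (R : realType) (n : nat) (r : R)
    (U : set 'cV[R]_n) (phi : 'cV[R]_n -> R) (x x' y v : 'cV[R]_n) :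
  open U -> Ck 2 U phi -> U x' -> c_dual r (grad phi x') x' y ->
  is_derive x' v (fun y => rsqrt_radicand r phi x y)
    (- (r ^+ 2 * rsqrt_radicand r phi x x' ^+ 3
        * (dot x (grad phi x') * dot x (hess phi x' *m v)
           - dot x' (grad phi x')
             * (dot v (grad phi x') + dot x' (hess phi x' *m v))))).
Proof.
move=> oU C2 Ux' gE; apply: is_derive_eq.
  apply: is_derive_rsqrt (radicand_gt0 x gE).
  exact: is_derive_radicand2 oU C2 Ux'.
by rewrite -/(rsqrt_radicand r phi x x'); field.
Qed.

(* With [A = x^T g'], [a = x'^T g'] and [W] the square root of the radicand,
   [(r A + W) (W - r A) = 1 - r^2 a^2]. *)
Lemma log_derivative_identity (R : realType) (r A a W dA da : R) :
  r != 0 -> W != 0 -> r * A + W != 0 -> r * a + 1 != 0 -> 1 - r * a != 0 ->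
  W ^+ 2 = r ^+ 2 * A ^+ 2 - r ^+ 2 * a ^+ 2 + 1 ->
  r^-1 * ((r * A + W)^-1 * (r * dA + W^-1 * (r ^+ 2 * (A * dA - a * da)))
          - (r * a + 1)^-1 * (r * da)) =
  W^-1 * dA + (r ^+ 2 * a * A * W^-1 - 1) / (1 - r ^+ 2 * a ^+ 2) * da.
Proof.
move=> r0 W0 N0 D0 D0' W2.
have qE : 1 - r ^+ 2 * a ^+ 2 = (r * a + 1) * (1 - r * a) by ring.
have NE : (r * A + W)^-1 = (W - r * A) / ((r * a + 1) * (1 - r * a)).
  apply: (mulfI N0); rewrite mulfV// mulrA.
  have -> : (r * A + W) * (W - r * A) = W ^+ 2 - r ^+ 2 * A ^+ 2 by ring.
  by rewrite W2; field; rewrite D0 D0'.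
have -> : (r * A + W)^-1 * (r * dA + W^-1 * (r ^+ 2 * (A * dA - a * da))) =
    r * dA / W - r ^+ 2 * a * da / W * (r * A + W)^-1.
  by field; rewrite W0 N0.
by rewrite NE qE; field; rewrite r0 W0 D0 D0'.
Qed.

Definition cdivergence_grad2 (R : realType) (n : nat) (r : R)
    (phi : 'cV[R]_n -> R) (x x' : 'cV[R]_n) : 'cV[R]_n :=
  let g := grad phi x' in
  let h := hess phi x' in
  let a := dot x' g in
  let q := rsqrt_radicand r phi x x' in
  - (g + q *: (h *m x)
     + ((r ^+ 2 * a * dot x g * q - 1) / (1 - r ^+ 2 * a ^+ 2))
       *: (g + h *m x')).

(** The product of the two factors is 1 - r^2 (x^T g)^2, a nonzero square by [sqr_dual_scale]. *)
Lemma dual_bounds (R : realType) (n : nat) (r : R) (g x y : 'cV[R]_n) :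
  c_dual r g x y -> r * dot x g + 1 != 0 /\ 1 - r * dot x g != 0.
Proof.
move=> /sqr_dual_scale gE.
have : 1 - r ^+ 2 * dot x g ^+ 2 != 0.
  by rewrite -gE expf_neq0// invr_neq0// gt_eqF// sqrtr_gt0 sqr_succ_gt0.
have -> : 1 - r ^+ 2 * dot x g ^+ 2 = (r * dot x g + 1) * (1 - r * dot x g).
  by ring.
by rewrite mulf_eq0 negb_or => /andP.
Qed.

(** Near x' the divergence agrees with its logarithmic form, whose dependence on the second variable
    is through phi and its gradient; that form is differentiated and simplified by
    [log_derivative_identity]. *)
Lemma grad2_cdivergence (R : realType) (n : nat) (r : R) (U : set 'cV[R]_n)
    (T : 'cV[R]_n -> 'cV[R]_n) (phi : 'cV[R]_n -> R) (x x' : 'cV[R]_n) :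
  0 < r -> open U -> Ck 2 U phi ->
  (forall y, U y -> c_dual r (grad phi y) y (T y)) -> U x' ->
  grad2 (cdivergence (arcsinh_cost r) T phi) x x' =
  cdivergence_grad2 r phi x x'.
Proof.
move=> r0 oU C2 gE Ux'; apply/colP => i; rewrite mxE.
set v := delta_mx i 0; rewrite -[RHS]dot_delta -/v.
have nU : \forall y \near x', U y by apply: open_nbhs_nbhs.
rewrite (@near_eq_derive _ _ _ _ (fun y => phi x - phi y
  - r^-1 * (ln (r * dot x (grad phi y) + Num.sqrt (radicand r phi x y))
            - ln (r * dot y (grad phi y) + 1)))); last first.
  by apply: filterS nU => y Uy; apply: cdivergenceE; exact: gE.
have dg := is_derive_grad v oU C2 Ux'.
have N0 := logarg_gt0 x (gE _ Ux').
(* The denominator in the logarithm is the numerator on the diagonal, where W = 1. *)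
have D0 : 0 < r * dot x' (grad phi x') + 1.
  by have := logarg_gt0 x' (gE _ Ux'); rewrite radicand_diag sqrtr1.
have W0 := radicand_gt0 x (gE _ Ux').
have dr := is_derive_radicand2 r x v oU C2 Ux'.
have dN := is_deriveD_fun
  (is_deriveM_fun (is_derive_cst r x' v) (is_derive_dotr x dg))
  (is_derive_comp dr (is_derive1_sqrt W0)).
have dD := is_deriveD_fun
  (is_deriveM_fun (is_derive_cst r x' v) (is_derive_dot (is_derive_id x' v) dg))
  (is_derive_cst (1 : R) x' v).
have dphi : is_derive x' v phi (dot v (grad phi x')).
  have dphi : differentiable phi x' by case: C2 => + _; apply.
  by rewrite -derive_grad//; apply: derivableP; exact: diff_derivable.
have [_ ->] := is_deriveD_fun
  (is_deriveD_fun (is_derive_cst (phi x) x' v) (is_deriveN_fun dphi))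
  (is_deriveN_fun (is_deriveM_fun (is_derive_cst r^-1 x' v)
    (is_deriveD_fun (is_derive_comp dN (is_derive1_ln N0))
      (is_deriveN_fun (is_derive_comp dD (is_derive1_ln D0)))))).
rewrite /cdivergence_grad2 !(dotNr, dotDr, dotZr).
rewrite (dot_hessC v x oU C2 Ux') (dot_hessC v x' oU C2 Ux') /rsqrt_radicand.
have [Dn Dn'] := dual_bounds (gE _ Ux').
have W2 := sqr_sqrtr (ltW W0); move/lt0r_neq0 : N0 => N0.
have Wn : Num.sqrt (radicand r phi x x') != 0 by rewrite gt_eqF ?sqrtr_gt0.
have := log_derivative_identity (dot x (hess phi x' *m v))
  (dot v (grad phi x') + dot x' (hess phi x' *m v)) (lt0r_neq0 r0) Wn N0 Dn Dn' W2.
rewrite /cst !mulr0 !addr0 add0r.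
have -> p : (2 * Num.sqrt (radicand r phi x x'))^-1 * (2 * r ^+ 2 * p) =
    (Num.sqrt (radicand r phi x x'))^-1 * (r ^+ 2 * p).
  by field.
move=> ->; ring.
Qed.

(** * Derivatives of the two gradients *)

Lemma is_derive_cdivergence_grad2 (R : realType) (n : nat) (r : R)
    (phi : 'cV[R]_n -> R) (x x' y v : 'cV[R]_n) :
  let g := grad phi x' in
  let h := hess phi x' in
  let q := rsqrt_radicand r phi x x' in
  c_dual r g x' y ->
  is_derive x v (fun z => cdivergence_grad2 r phi z x')
    (- (q *: (h *m v)
        + (- (r ^+ 2 * q ^+ 3 * (dot x g * dot v g))) *: (h *m x)
        + (r ^+ 2 * dot x' g * dot v g * q ^+ 3) *: (g + h *m x'))).
Proof.
move=> g h q gE; have dq := is_derive_rsqrt_radicand1 x v gE.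
rewrite -/q -/g in dq.
have W0 := radicand_gt0 x gE.
have [Dn Dn'] := dual_bounds gE.
rewrite /cdivergence_grad2 -/g -/h; apply: is_derive_eq.
  apply: is_deriveN_fun; apply: is_deriveD_fun.
    apply: is_deriveD_fun.
    by apply: is_deriveZ_fun dq _; exact: is_derive_mulmx.
  apply: is_deriveZ_fun; apply: is_deriveM_fun; apply: is_deriveD_fun.
  apply: is_deriveM_fun dq; apply: is_deriveM_fun.
  exact: is_derive_dotl.
rewrite /= scaler0 !mulr0 !addr0 !add0r -/q; congr (- (_ + _ *: _)).
  by rewrite addrC.
have En : 1 - r ^+ 2 * dot x' g ^+ 2 != 0.
  have -> : 1 - r ^+ 2 * dot x' g ^+ 2 = (r * dot x' g + 1) * (1 - r * dot x' g).
    by ring.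
  by rewrite mulf_neq0.
have q2 : q ^+ 2 * radicand r phi x x' = 1.
  rewrite /q /rsqrt_radicand -{2}(sqr_sqrtr (ltW W0)) -exprMn mulVf ?expr1n//.
  by rewrite gt_eqF ?sqrtr_gt0.
(* In this form q^2 W^2 = 1 supplies a factor 1 - r^2 (x'^T g)^2 that cancels the denominator of the
   coefficient of [g + h *m x']. *)
have {q2} q2 : 1 - r ^+ 2 * dot x g ^+ 2 * q ^+ 2 =
    q ^+ 2 * (1 - r ^+ 2 * dot x' g ^+ 2).
  by rewrite -[X in X - _]q2 /radicand -/g; ring.
apply: (mulfI En); rewrite mulVKf//.
have -> : (1 - r ^+ 2 * dot x' g ^+ 2) * (r ^+ 2 * dot x' g * dot v g * q ^+ 3) =
    r ^+ 2 * dot x' g * dot v g * q * (q ^+ 2 * (1 - r ^+ 2 * dot x' g ^+ 2)).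
  by ring.
by rewrite -q2; ring.
Qed.

(** The function is the derivative found in [is_derive_cdivergence_grad2] with x' frozen at x. At z
    = x one has q = 1, so q and q^3 contribute only through their derivatives. *)
Lemma is_derive2_cdivergence_grad2 (R : realType) (n : nat) (r : R)
    (phi : 'cV[R]_n -> R) (x y u v : 'cV[R]_n) :
  let g := grad phi x in
  let h := hess phi x in
  c_dual r g x y ->
  is_derive x u
    (fun z => - (rsqrt_radicand r phi z x *: (h *m v)
       + (- (r ^+ 2 * rsqrt_radicand r phi z x ^+ 3 * (dot z g * dot v g)))
         *: (h *m z)
       + (r ^+ 2 * dot x g * dot v g * rsqrt_radicand r phi z x ^+ 3)
         *: (g + h *m x)))
    ((r ^+ 2 * dot x g * dot u g) *: (h *m v)
     + (r ^+ 2 * dot u g * dot v g) *: (h *m x)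
     + (r ^+ 2 * dot x g * dot v g) *: (h *m u)
     + (3 * r ^+ 4 * dot x g ^+ 2 * dot u g * dot v g) *: g).
Proof.
move=> g h gE; have dq := is_derive_rsqrt_radicand1 x u gE.
rewrite rsqrt_radicand_diag -/g in dq.
have dq3 := is_deriveX_fun 3 dq.
have dA := is_deriveZ_fun dq (is_derive_cst (h *m v) x u).
have dB := is_deriveZ_fun
  (is_deriveN_fun (is_deriveM_fun
    (is_deriveM_fun (is_derive_cst (r ^+ 2) x u) dq3)
    (is_deriveM_fun (is_derive_dotl x u g) (is_derive_cst (dot v g) x u))))
  (is_derive_mulmx h (is_derive_id x u)).
have dC := is_deriveZ_fun
  (is_deriveM_fun (is_derive_cst (r ^+ 2 * dot x g * dot v g) x u) dq3)
  (is_derive_cst (g + h *m x) x u).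
apply: (is_derive_eq (is_deriveN_fun (is_deriveD_fun (is_deriveD_fun dA dB) dC))).
rewrite /cst /= !scaler0 rsqrt_radicand_diag; apply: dot_ext => w.
by rewrite !(dotNr, dotDr, dotZr, dot0r); ring.
Qed.

Lemma is_derive_cdivergence_grad1 (R : realType) (n : nat) (r : R) (U : set 'cV[R]_n)
    (phi : 'cV[R]_n -> R) (x x' y v : 'cV[R]_n) :
  let g := grad phi x' in
  let h := hess phi x' in
  let q := rsqrt_radicand r phi x x' in
  open U -> Ck 2 U phi -> U x' -> c_dual r g x' y ->
  is_derive x' v (fun y => grad phi x - rsqrt_radicand r phi x y *: grad phi y)
    ((r ^+ 2 * q ^+ 3 * (dot x g * dot x (h *m v)
       - dot x' g * (dot v g + dot x' (h *m v)))) *: g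
     - q *: (h *m v)).
Proof.
move=> g h q oU C2 Ux' gE.
have dg := is_derive_grad v oU C2 Ux'.
have dq := is_derive_rsqrt_radicand2 x v oU C2 Ux' gE.
apply: is_derive_eq.
  apply: is_deriveD_fun; apply: is_deriveN_fun; exact: is_deriveZ_fun dq dg.
by rewrite add0r opprD scaleNr opprK.
Qed.

Lemma is_derive2_cdivergence_grad1 (R : realType) (n : nat) (r : R) (U : set 'cV[R]_n)
    (phi : 'cV[R]_n -> R) (x y u v : 'cV[R]_n) :
  let g := grad phi in
  let h := hess phi in
  open U -> Ck 3 U phi -> U x -> c_dual r (g x) x y ->
  is_derive x u
    (fun z => (r ^+ 2 * rsqrt_radicand r phi x z ^+ 3
       * (dot x (g z) * dot x (h z *m v)
          - dot z (g z) * (dot v (g z) + dot z (h z *m v)))) *: g z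
       - rsqrt_radicand r phi x z *: (h z *m v))
    (- (third_vec phi x u v
        + (r ^+ 2 * (dot x (g x) * dot u (g x))) *: (h x *m v)
        + (r ^+ 2 * (dot v (g x) * dot x (g x))) *: (h x *m u)
        + (r ^+ 2 * ((1 + 3 * r ^+ 2 * dot x (g x) ^+ 2)
                       * (dot u (g x) * dot v (g x))
                     + 2 * dot u (h x *m v) * dot x (g x)
                     + dot v (g x) * dot x (h x *m u)
                     + dot u (g x) * dot x (h x *m v))) *: g x)).
Proof.
move=> g h oU C3 Ux gE; have C2 := Ck_le C3.
have dg : is_derive x u g (h x *m u) := is_derive_grad u oU C2 Ux.
have dh : is_derive x u (fun z => h z *m v) (third_vec phi x u v) :=
  is_derive_hess u v oU C3 Ux.
have dq := is_derive_rsqrt_radicand2 x u oU C2 Ux gE.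
rewrite rsqrt_radicand_diag -/g -/h in dq.
have dq3 := is_deriveX_fun 3 dq.
have did := is_derive_id x u.
have dP := is_deriveD_fun
  (is_deriveM_fun (is_derive_dotr x dg) (is_derive_dotr x dh))
  (is_deriveN_fun (is_deriveM_fun (is_derive_dot did dg)
    (is_deriveD_fun (is_derive_dotr v dg) (is_derive_dot did dh)))).
have dA := is_deriveZ_fun
  (is_deriveM_fun (is_deriveM_fun (is_derive_cst (r ^+ 2) x u) dq3) dP) dg.
apply: (is_derive_eq (is_deriveD_fun dA (is_deriveN_fun (is_deriveZ_fun dq dh)))).
rewrite /cst /= rsqrt_radicand_diag -/g -/h; apply: dot_ext => w.
(* Two terms u^T h v and v^T h u arise, from differentiating v^T g and z; symmetry of the Hessian
   merges them into the term with coefficient 2. *)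
rewrite !(dotNr, dotDr, dotZr, dot0r) (dot_hessC v u oU C2 Ux) -/h; ring.
Qed.

(** * The c-Hessian as an invertible matrix *)

(** A singular matrix kills a nonzero vector, at which the quadratic form would vanish. *)
Lemma posdef_bijective (R : realType) (n : nat) (A : 'M[R]_n) :
  (forall u : 'cV[R]_n, u != 0 -> 0 < dot u (A *m u)) ->
  bijective (fun u : 'cV[R]_n => A *m u).
Proof.
move=> A0; have uA : A \in unitmx.
  rewrite -unitmx_tr unitmxE unitfE; apply/det0P => -[v v0 vA].
  have := A0 v^T; rewrite -[A]trmxK -trmx_mul vA trmx0 dot0r ltxx.
  by move=> /(_ _)/notF; apply; rewrite -trmx0 (inj_eq trmx_inj).
by exists (fun u => invmx A *m u) => u; rewrite mulmxA ?mulVmx ?mulmxV// mul1mx.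
Qed.

(** Differentiating the cost gradient gives r^2 (x^T y)(u^T y) y / s^3; the three factors 1 / s turn
    the three occurrences of y into the gradient of phi. *)
Lemma chess_cost (R : realType) (n : nat) (r : R) (T : 'cV[R]_n -> 'cV[R]_n)
    (phi : 'cV[R]_n -> R) (x u : 'cV[R]_n) :
  0 < r -> c_dual r (grad phi x) x (T x) ->
  chess (arcsinh_cost r) T phi x u =
  hess phi x *m u
  + (r ^+ 2 * (dot x (grad phi x) * dot (grad phi x) u)) *: grad phi x.
Proof.
move=> r0 gE; rewrite /chess /D1.
have [_ ->] := is_derive_grad1_cost x u (T x) r0.
rewrite addrC gE; apply: dot_ext => w; rewrite !(dotDr, dotZr, dotZl).
by rewrite (dotC (T x) u); ring.
Qed.

Lemma rank_one_update_mulmx (R : realType) (n : nat) (h : 'M[R]_n) (k : R)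
    (g u : 'cV[R]_n) :
  h *m u + (k * dot g u) *: g = (h + k *: (g *m g^T)) *m u.
Proof.
rewrite mulmxDl -scalemxAl -mulmxA [g^T *m u]mx11_scalar mul_mx_scalar scalerA.
by [].
Qed.

(** Evaluates an inverse by checking a proposed preimage; both connections are identified this
    way. *)
Lemma pinvT_eq (T : pointedType) (A : T -> T) (a b : T) :
  injective A -> A a = b -> pinv setT A b = a.
Proof.
by move=> injA <-; apply: (pinvKV (fun=> point)); rewrite ?inE// => p q _ _ /injA.
Qed.

(** * Mixed derivatives of the divergence *)

Lemma D1_grad2_cdivergence (R : realType) (n : nat) (r : R)
    (U : set 'cV[R]_n) (T : 'cV[R]_n -> 'cV[R]_n) (phi : 'cV[R]_n -> R)
    (x x' v : 'cV[R]_n) :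
  let g := grad phi x' in
  let h := hess phi x' in
  let q := rsqrt_radicand r phi x x' in
  0 < r -> open U -> Ck 2 U phi ->
  (forall y, U y -> c_dual r (grad phi y) y (T y)) -> U x' ->
  D1 v (grad2 (cdivergence (arcsinh_cost r) T phi)) x x' =
  - (q *: (h *m v) + (- (r ^+ 2 * q ^+ 3 * (dot x g * dot v g))) *: (h *m x)
     + (r ^+ 2 * dot x' g * dot v g * q ^+ 3) *: (g + h *m x')).
Proof.
move=> g h q r0 oU C2 gE Ux'; rewrite /D1.
(* The formula for the gradient in x' holds for every first argument, so it can be rewritten under
   the binder. *)
under eq_fun do rewrite (grad2_cdivergence _ r0 oU C2 gE Ux').
by have [_ ->] := is_derive_cdivergence_grad2 x v (gE _ Ux').
Qed.

Lemma D1_D1_grad2_cdivergence (R : realType) (n : nat) (r : R)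
    (U : set 'cV[R]_n) (T : 'cV[R]_n -> 'cV[R]_n) (phi : 'cV[R]_n -> R)
    (x u v : 'cV[R]_n) :
  let g := grad phi x in
  let h := hess phi x in
  0 < r -> open U -> Ck 2 U phi ->
  (forall y, U y -> c_dual r (grad phi y) y (T y)) -> U x ->
  D1 u (D1 v (grad2 (cdivergence (arcsinh_cost r) T phi))) x x =
  (r ^+ 2 * dot x g * dot u g) *: (h *m v)
  + (r ^+ 2 * dot u g * dot v g) *: (h *m x)
  + (r ^+ 2 * dot x g * dot v g) *: (h *m u)
  + (3 * r ^+ 4 * dot x g ^+ 2 * dot u g * dot v g) *: g.
Proof.
move=> g h r0 oU C2 gE Ux; rewrite {1}/D1.
under eq_fun do rewrite (D1_grad2_cdivergence _ _ r0 oU C2 gE Ux).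
by have [_ ->] := is_derive2_cdivergence_grad2 u v (gE _ Ux).
Qed.

Lemma D2_grad1_cdivergence (R : realType) (n : nat) (r : R)
    (U : set 'cV[R]_n) (T : 'cV[R]_n -> 'cV[R]_n) (phi : 'cV[R]_n -> R)
    (x x' v : 'cV[R]_n) :
  let g := grad phi x' in
  let h := hess phi x' in
  let q := rsqrt_radicand r phi x x' in
  0 < r -> open U -> Ck 2 U phi ->
  (forall y, U y -> c_dual r (grad phi y) y (T y)) -> U x -> U x' ->
  D2 v (grad1 (cdivergence (arcsinh_cost r) T phi)) x x' =
  (r ^+ 2 * q ^+ 3 * (dot x g * dot x (h *m v)
     - dot x' g * (dot v g + dot x' (h *m v)))) *: g
  - q *: (h *m v).
Proof.
move=> g h q r0 oU C2 gE Ux Ux'; rewrite /D2.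
(* In the second variable the closed form is available on U, a neighbourhood of x', and equality
   near x' suffices. *)
rewrite (@near_eq_derive _ _ _ _
  (fun y => grad phi x - rsqrt_radicand r phi x y *: grad phi y)).
  by have [_ ->] := is_derive_cdivergence_grad1 x v oU C2 Ux' (gE _ Ux').
have : \forall y \near x', U y by apply: open_nbhs_nbhs.
apply: filterS => y Uy; apply: grad1_cdivergence r0 (gE _ Uy) _.
by case: C2 => + _; apply.
Qed.

Lemma D2_D2_grad1_cdivergence (R : realType) (n : nat) (r : R)
    (U : set 'cV[R]_n) (T : 'cV[R]_n -> 'cV[R]_n) (phi : 'cV[R]_n -> R)
    (x u v : 'cV[R]_n) :
  let g := grad phi x in
  let h := hess phi x in
  0 < r -> open U -> Ck 3 U phi ->
  (forall y, U y -> c_dual r (grad phi y) y (T y)) -> U x ->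
  D2 u (D2 v (grad1 (cdivergence (arcsinh_cost r) T phi))) x x =
  - (third_vec phi x u v
     + (r ^+ 2 * (dot x g * dot u g)) *: (h *m v)
     + (r ^+ 2 * (dot v g * dot x g)) *: (h *m u)
     + (r ^+ 2 * ((1 + 3 * r ^+ 2 * dot x g ^+ 2) * (dot u g * dot v g)
                  + 2 * dot u (h *m v) * dot x g
                  + dot v g * dot x (h *m u)
                  + dot u g * dot x (h *m v))) *: g).
Proof.
move=> g h r0 oU C3 gE Ux; have [_ <-] := is_derive2_cdivergence_grad1 u v oU C3 Ux (gE _ Ux).
apply: near_eq_derive; have : \forall y \near x, U y by apply: open_nbhs_nbhs.
apply: filterS => y Uy.
exact: D2_grad1_cdivergence r0 oU (Ck_le C3) gE Ux Uy.
Qed.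

(** [D1 u F] is the pairing of u with [grad1 F], and pairing with a fixed vector commutes with
    differentiation in x'. This relates the metric to [mixed2]. *)
Lemma D2_D1_cdivergence (R : realType) (n : nat) (r : R)
    (U : set 'cV[R]_n) (T : 'cV[R]_n -> 'cV[R]_n) (phi : 'cV[R]_n -> R)
    (x x' u v : 'cV[R]_n) :
  let F := cdivergence (arcsinh_cost r) T phi in
  0 < r -> open U -> Ck 2 U phi ->
  (forall y, U y -> c_dual r (grad phi y) y (T y)) -> U x -> U x' ->
  D2 v (D1 u F) x x' = dot u (D2 v (grad1 F) x x').
Proof.
move=> F r0 oU C2 gE Ux Ux'.
have nU : \forall y \near x', U y by apply: open_nbhs_nbhs.
have dphi y : U y -> differentiable phi y by case: C2 => + _; apply.
have dG := is_derive_cdivergence_grad1 x v oU C2 Ux' (gE _ Ux').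
rewrite (D2_grad1_cdivergence v r0 oU C2 gE Ux Ux').
have [_ <-] := is_derive_dotr u dG.
apply: near_eq_derive; apply: filterS nU => y Uy; rewrite /D1.
by have [_ ->] := is_derive_cdivergence1 u r0 (gE _ Uy) (dphi _ Ux).
Qed.

(** * Symmetry of the cubic tensor, and assembly of the results *)

(** Besides t, the expression consists of symmetrized products of the linear forms l and m with each
    other and with the symmetric bilinear form b. *)
Lemma symmetric_tensor3_cubic (R : realType) (n : nat)
    (t : 'cV[R]_n -> 'cV[R]_n -> 'cV[R]_n -> R) (b : 'cV[R]_n -> 'cV[R]_n -> R)
    (l m : 'cV[R]_n -> R) (k c d : R) :
  symmetric_tensor3 t -> (forall v, scalar (fun u => b u v)) ->
  (forall u v, b u v = b v u) -> scalar l -> scalar m ->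
  symmetric_tensor3 (fun u v w => t u v w + k *
    (c * (l u * b v w + l v * b u w + l w * b v u) + d * (l w * l u * l v)
     + l w * l v * m u + l u * l v * m w + l w * l u * m v)).
Proof.
move=> [tl tCl tCr] bl bC ll ml; split=> [v w a u u'|u v w|u v w].
- by rewrite tl ll ml !(bC v) !bl; ring.
- by rewrite tCl (bC u v); ring.
- by rewrite tCr (bC w v) (bC w u) (bC v u); ring.
Qed.

Theorem proposition5 (R : realType) (n : nat) (r : R)
    (Omega Omegabar : set 'cV[R]_n) (phi : 'cV[R]_n -> R)
    (hr : 0 < r) (hOmega : domain Omega) (hOmegabar : domain Omegabar)
    (hphi : Ck 3 Omega phi)
    (hconvex : cconvex (arcsinh_cost r) Omega Omegabar phi)
    (hlegendre : clegendre (arcsinh_cost r) Omega Omegabar phi) :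
  let T := optmap (arcsinh_cost r) Omega Omegabar phi in
  let F := cdivergence (arcsinh_cost r) T phi in
  (forall x x', Omega x -> Omega x' ->
     F x x' = phi x - phi x'
       - r^-1 * ln ((r * dot x (grad phi x')
                     + Num.sqrt (r ^+ 2 * dot x (grad phi x') ^+ 2
                                 - r ^+ 2 * dot x' (grad phi x') ^+ 2 + 1))
                    / (r * dot x' (grad phi x') + 1))) /\
  (forall x, Omega x ->
     let g := grad phi x in
     let h := hess phi x in
     let H := chess (arcsinh_cost r) T phi x in
     let C := amari_chentsov (arcsinh_cost r) T phi x in
     [/\ divergence_metric F x H
         /\ (forall u, H u = h *m u + (r ^+ 2 * (dot x g * dot g u)) *: g),
         bijective (mixed1 F x) /\ bijective (mixed2 F x)
         /\ bijective H,
         (forall u v, primal_connection F x u v =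
            - (r ^+ 2 *: ((dot g u * dot g v) *: x
                          + (dot x g * dot g v) *: u
                          + (dot x g * dot g u) *: v))),
         (forall u v, dual_connection F x u v =
            pinv setT H
              (third_vec phi x u v
               + (r ^+ 2 * (dot x g * dot u g)) *: (h *m v)
               + (r ^+ 2 * (dot v g * dot x g)) *: (h *m u)
               + (r ^+ 2 * ((1 + 3 * r ^+ 2 * dot x g ^+ 2)
                              * (dot u g * dot v g)
                            + 2 * dot u (h *m v) * dot x g
                            + dot v g * dot x (h *m u)
                            + dot u g * dot x (h *m v))) *: g)) &
         (forall u v w, C u v w =
            third phi x u v w
            + r ^+ 2 *
              (2 * dot x g * (dot u g * dot v (h *m w)
                              + dot v g * dot u (h *m w)
                              + dot w g * dot v (h *m u))
               + (1 + 6 * r ^+ 2 * dot x g ^+ 2)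
                   * (dot w g * dot u g * dot v g)
               + dot w g * dot v g * dot x (h *m u)
               + dot u g * dot v g * dot x (h *m w)
               + dot w g * dot u g * dot x (h *m v)))
         /\ symmetric_tensor3 C]).
Proof.
move=> T F; have [oO _ _] := hOmega; have [wd _ Hpos] := hlegendre.
have C2 := Ck_le hphi.
have gE y : Omega y -> c_dual r (grad phi y) y (T y).
  by apply: grad_optmap; case: hphi.
split=> [x x' Ox Ox'|x Ox g h H C].
  rewrite /F cdivergenceE; last exact: gE.
  rewrite ln_div// posrE; first exact: logarg_gt0 (gE _ Ox').
  by have := logarg_gt0 x' (gE _ Ox'); rewrite radicand_diag sqrtr1.
have HE u : H u = h *m u + (r ^+ 2 * (dot x g * dot g u)) *: g.
  exact: chess_cost hr (gE _ Ox).
have hC u v : dot u (h *m v) = dot v (h *m u) by exact: dot_hessC oO C2 Ox.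
have HM : H = mulmx (h + (r ^+ 2 * dot x g) *: (g *m g^T)).
  by apply/funext => u; rewrite HE mulrA rank_one_update_mulmx.
(* Positive definiteness comes from the Legendre condition. *)
have bijH : bijective H.
  rewrite HM; apply: posdef_bijective => u u0.
  by have := Hpos x Ox u u0; rewrite -/H HM.
have linH : linear H by rewrite HM => a u v; rewrite linearP.
have bijHN : bijective (fun u => - H u).
  by apply: (bij_comp (inv_bij (@opprK _)) bijH).
(* At q = 1 the two multiples of [h *m x] cancel, leaving minus the c-Hessian. *)
have m1E : mixed1 F x = fun u => - H u.
  apply/funext => u; rewrite /mixed1 (D1_grad2_cdivergence _ _ hr oO C2 gE Ox).
  rewrite rsqrt_radicand_diag HE -/g -/h; apply: dot_ext => w.
  by rewrite !(dotNr, dotDr, dotZr) (dotC g u); ring.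
have m2E : mixed2 F x = fun u => - H u.
  apply/funext => u; rewrite /mixed2 (D2_grad1_cdivergence _ hr oO C2 gE Ox Ox).
  rewrite rsqrt_radicand_diag HE -/g -/h; apply: dot_ext => w.
  by rewrite !(dotNr, dotDr, dotZr) (dotC g u); ring.
have primalE u v : primal_connection F x u v =
    - (r ^+ 2 *: ((dot g u * dot g v) *: x + (dot x g * dot g v) *: u
                  + (dot x g * dot g u) *: v)).
  apply: pinvT_eq; first by rewrite m1E; exact: bij_inj.
  (* Applying -H to the proposed value: the rank-one part of H contributes r^4 (x^T g)^2 (g^T u)(g^T
     v) g once for each of the three vectors, hence the coefficient 3. *)
  rewrite m1E (D1_D1_grad2_cdivergence u v hr oO C2 gE Ox) -/g -/h HE.
  rewrite -scaleN1r; apply: dot_ext => w.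
  rewrite !(linearD, linearN, linearZ)/=.
  rewrite !(dotNr, dotDr, dotZr) (dotC g x) (dotC g u) (dotC g v); ring.
pose X u v := third_vec phi x u v
  + (r ^+ 2 * (dot x g * dot u g)) *: (h *m v)
  + (r ^+ 2 * (dot v g * dot x g)) *: (h *m u)
  + (r ^+ 2 * ((1 + 3 * r ^+ 2 * dot x g ^+ 2) * (dot u g * dot v g)
               + 2 * dot u (h *m v) * dot x g
               + dot v g * dot x (h *m u)
               + dot u g * dot x (h *m v))) *: g.
have HK b : H (pinv setT H b) = b.
  have [Hi HiK HKi] := bijH; rewrite -{1}(HKi b).
  by rewrite (pinvT_eq (bij_inj bijH) erefl) HKi.
(* The minus signs of [mixed2] and of the second derivative cancel. *)
have dualE u v : dual_connection F x u v = pinv setT H (X u v).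
  apply: pinvT_eq; first by rewrite m2E; exact: bij_inj.
  by rewrite m2E HK (D2_D2_grad1_cdivergence u v hr oO hphi gE Ox).
have CE u v w : C u v w =
    third phi x u v w + r ^+ 2 *
      (2 * dot x g * (dot u g * dot v (h *m w) + dot v g * dot u (h *m w)
                      + dot w g * dot v (h *m u))
       + (1 + 6 * r ^+ 2 * dot x g ^+ 2) * (dot w g * dot u g * dot v g)
       + dot w g * dot v g * dot x (h *m u)
       + dot u g * dot v g * dot x (h *m w)
       + dot w g * dot u g * dot x (h *m v)).
  rewrite /C /amari_chentsov -/F -/H dualE primalE.
  (* The primal connection is -Y, so H maps the difference of the connections to [X u v + H Y], with
     no inverse left. The term [H Y] raises the coefficient 3 to 6. *)
  set Y := _ *: (_ + _).
  have -> : H (pinv setT H (X u v) - - Y) = X u v + H Y.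
    by rewrite HM -HM opprK; rewrite -[in RHS](HK (X u v)) HM linearD.
  rewrite HE /X /Y !(linearD, linearZ)/= !(dotDr, dotZr).
  rewrite -(third_grad u v w oO hphi Ox) (dotC g x) (dotC g u) (dotC g v).
  rewrite (hC w u) (hC w v) (hC w x) (hC v u); ring.
split; [split; [|exact: HE]|by rewrite m1E m2E|exact: primalE|exact: dualE|].
  split; first exact: linH.
    move=> u v; rewrite !HE !(dotDr, dotZr) (hC u v) (dotC g u) (dotC g v).
    by ring.
  (* The quadratic form of the metric is minus the pairing of u with [mixed2 F x u], which is -H
     u. *)
  move=> u; rewrite (D2_D1_cdivergence _ _ hr oO C2 gE Ox Ox).
  by rewrite -/(mixed2 F x u) m2E dotNr opprK.
split; first exact: CE.
have tS : symmetric_tensor3 (third phi x).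
  split=> [v w|u v w|u v w]; first exact: third_linear hphi Ox.
    exact: thirdCl oO hphi Ox.
  exact: thirdCr oO hphi Ox.
have bl v : scalar (fun u => dot u (h *m v)).
  by move=> a u u'; rewrite dotDl dotZl.
have ll : scalar (fun u => dot u g) by move=> a u u'; rewrite dotDl dotZl.
have ml : scalar (fun u => dot x (h *m u)).
  by move=> a u u'; rewrite mulmxDr -scalemxAr dotDr dotZr.
(* Here b is the Hessian form, l pairs with g, and m is u |-> x^T h u. *)
have S := symmetric_tensor3_cubic (r ^+ 2) (2 * dot x g)
  (1 + 6 * r ^+ 2 * dot x g ^+ 2) tS bl hC ll ml.
rewrite (funext (fun u => funext (fun v => funext (CE u v)))).
exact: S.
Qed.
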